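(* Let $G$ be a connected graph of order $n$ and diameter $D$, and let $H$ be a proper subgraph of $G$. Then $$\mu(G)-\mu(H)>\frac{1}{\mu^{2D}(G)\,n}.$$
   Context: Graphs are finite, simple and undirected, with nonempty vertex set; the order of a graph is its number of vertices. $\mu(G)$ denotes the largest eigenvalue of the adjacency matrix of $G$, and $\mu^{2D}(G)=(\mu(G))^{2D}$. A proper subgraph of $G$ is a subgraph different from $G$ (it may have fewer vertices, or the same vertices and fewer edges, and need not be connected). The diameter is the maximum over pairs of vertices of the length of a shortest path joining them. *)

(* Defs.v *)
From HB Require Import structures.
From mathcomp Require Import all_boot all_order all_algebra.
From mathcomp Require Import reals.
From mathcomp Require classical_sets.

Set Implicit Arguments.
Unset Strict Implicit.
Unset Printing Implicit Defensive.

Import Order.TTheory GRing.Theory Num.Theory.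

(* MathComp world. *)

(* Finite simple graphs whose vertices are taken in an ambient finite type [T],
   so that a graph and its subgraphs live in the same type. Edges are
   two-element sets of vertices. *)
Record sgraph (T : finType) := SGraph {
  vertices : {set T};
  edges : {set {set T}};
  vertices_neq0 : vertices != set0;
  edgesP : [forall f in edges, (f \subset vertices) && (#|f| == 2)]
}.

Section Graph.
Variable T : finType.
Implicit Types (G H : sgraph T) (x y : T).

(* [adjacent G x x] is false because [[set x; x]] has only one element. *)
Definition adjacent G : rel T := fun x y => [set x; y] \in edges G.

Definition subgraph H G : Prop :=
  vertices H \subset vertices G /\ edges H \subset edges G.

Definition proper_subgraph H G : Prop :=
  subgraph H G /\ (vertices H, edges H) <> (vertices G, edges G).

Definition joined_by_path G x y (k : nat) : bool :=
  [exists p : k.-tuple T,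
     [&& path (adjacent G) x p, uniq (x :: p) & last x p == y]].

Definition connected_graph G : Prop :=
  forall x y, x \in vertices G -> y \in vertices G ->
  exists k, joined_by_path G x y k.

(* A path has fewer than [#|T|] edges, so the range of [k] is no restriction;
   the value is [#|T|] when no path joins [x] to [y]. *)
Definition distance G x y : nat :=
  [arg min_(k < (ord_max : 'I_#|T|.+1) | joined_by_path G x y k) (k : nat)]%N.

Definition diameter G : nat :=
  \max_(x in vertices G) \max_(y in vertices G) distance G x y.

End Graph.

Local Open Scope ring_scope.

Definition adjacency_matrix (R : realType) (T : finType) (G : sgraph T) :
    'M[R]_#|vertices G| :=
  \matrix_(i, j) (adjacent G (enum_val i) (enum_val j))%:R.

Definition is_largest_eigenvalue (R : realType) (n : nat) (A : 'M[R]_n)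
    (m : R) : Prop :=
  eigenvalue A m /\ forall a : R, eigenvalue A a -> a <= m.

(* The default value [0] is never used: the adjacency matrix is real symmetric
   of positive size, so it has a largest eigenvalue. *)
Definition mu (R : realType) (T : finType) (G : sgraph T) : R :=
  classical_sets.xget 0 (is_largest_eigenvalue (adjacency_matrix R G)).

(* Main.v *)
Require Import Defs.
From HB Require Import structures.
From mathcomp Require Import all_boot all_order all_algebra.
From mathcomp Require Import reals.
From mathcomp Require Import classical_sets topology normedtype derive.
From mathcomp Require Import ring lra.

Set Implicit Arguments.
Unset Strict Implicit.
Unset Printing Implicit Defensive.

Import Order.TTheory GRing.Theory Num.Theory.
Import numFieldNormedType.Exports.
(* These two are imported again so that the names shared with sets in the
   sense of classical logic refer to finite sets. *)
Import mathcomp.boot.fintype mathcomp.boot.finset.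
Local Open Scope ring_scope.

(** Let [f] and [g] be nonnegative unit eigenvectors of [G] and [H] for [mu G]
    and [mu H], extended by zero to the ambient vertex type.  Evaluating the
    bilinear forms of both adjacency matrices at [(f, g)] gives
      [(mu G - mu H) * <f, g> = sum of f x * g y],
    the sum ranging over ordered pairs [(x, y)] that are adjacent in [G] but not
    in [H] ([mu_diff_inner]).  All terms are nonnegative, so a missing edge [uv]
    contributes at least [f v * g u + f u * g v], while [<f, g> <= 1].

    It remains to choose [uv] so that [f v * g u] is large. Along an edge the
    entries of a nonnegative eigenvector shrink by a factor of at most [mu]. As
    [G] is connected, every entry of [f] on a vertex of [G] is at least [mu G ^-
    D] times the largest one ([perron_lower_bound]). The graph [H] may be
    disconnected or have a much larger diameter, but from a vertex [w] where [g]
    is maximal one can walk in [G], in at most [D] steps, towards an end of a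
    missing edge; up to the first such end [u] that is met the walk uses edges
    of [H] only, so that [g w <= mu G ^+ D * g u] ([perron_escape]). The largest
    entries of [f] and [g] have squares at least [1 / n], hence [f v * g u >= 1
    / (mu G ^+ 2D * n)].

    The inequality is strict because either [<f, g> < 1], or [f = g], and then
    the second term [f u * g v] is positive.

    The nonnegative eigenvectors come from maximizing the Rayleigh quotient on
    the unit sphere ([perron_symmetric]). *)

(** * Largest eigenvalue of a nonnegative symmetric matrix *)

Section Rayleigh.
Variables (R : realType) (n : nat).
Implicit Types (A : 'M[R]_n) (u v z : 'rV[R]_n).

(** Bilinear form of [A], as an explicit double sum so that continuity and
    entrywise bounds apply directly; [form 1%:M] is the scalar product. *)
Definition form A u v : R := \sum_i \sum_j u 0 i * A i j * v 0 j.

Lemma formE A u v : form A u v = (u *m A *m v^T) 0 0.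
Proof.
rewrite mxE /form exchange_big; apply: eq_bigr => j _ /=.
by rewrite !mxE big_distrl.
Qed.

Lemma form_expand A u z t : A^T = A ->
  form A (u + t *: z) (u + t *: z)
  = form A u u + 2 * t * form A u z + t ^+ 2 * form A z z.
Proof.
move=> symA.
have form_sym : form A z u = form A u z.
  rewrite !formE -[in RHS]symA -[in LHS](trmxK (z *m A *m u^T)) mxE.
  by rewrite !trmx_mul trmxK mulmxA.
have -> : form A (u + t *: z) (u + t *: z) =
    form A u u + t * form A u z + t * form A z u + t ^+ 2 * form A z z.
  rewrite !formE linearD /= linearZ /= !mulmxDl !mulmxDr.
  rewrite -!scalemxAl -!scalemxAr.
  by rewrite !mxE; ring.
by rewrite form_sym; ring.
Qed.

Lemma formZ A t u : form A (t *: u) (t *: u) = t ^+ 2 * form A u u.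
Proof. by rewrite !formE linearZ /= -scalemxAr -!scalemxAl !mxE; ring. Qed.

Lemma form1E u v : form 1%:M u v = \sum_i u 0 i * v 0 i.
Proof. by rewrite formE mulmx1 mxE; apply: eq_bigr => i _; rewrite mxE. Qed.

Lemma form1_ge0 u : 0 <= form 1%:M u u.
Proof. by rewrite form1E sumr_ge0 // => i _; rewrite -expr2 sqr_ge0. Qed.

Lemma form1_eq0 u : form 1%:M u u = 0 -> u = 0.
Proof.
rewrite form1E => u0; apply/rowP => i; rewrite mxE.
apply/eqP; rewrite -sqrf_eq0 expr2; apply/eqP.
by apply: (psumr_eq0P _ u0) => // j _; rewrite -expr2 sqr_ge0.
Qed.

Lemma continuous_form A : continuous (fun u => form A u u).
Proof.
apply: continuous_big => [x|i _]; first exact: add_continuous.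
apply: continuous_big => [x|j _]; first exact: add_continuous.
move=> u.
apply: (@continuousM R _ (fun u : 'rV[R]_n => u 0 i * A i j)
  (fun u : 'rV[R]_n => u 0 j)); last exact: coord_continuous.
by apply: (@continuousM R _ (fun u : 'rV[R]_n => u 0 i) (fun=> A i j));
  [exact: coord_continuous|exact: cst_continuous].
Qed.

Lemma compact_sphere : compact [set u | form 1%:M u u = 1]%classic.
Proof.
have closed_sphere : closed [set u | form 1%:M u u = 1]%classic.
  apply: (@preimage_closed _ _ (fun u => form 1%:M u u)
            [set x | x = 1]%classic).
    by move=> u _; exact: continuous_form.
  exact: closed_eq.
pose cube := @rV_compact R n (fun=> `[(-1 : R), 1]%classic).
apply: (subclosed_compact closed_sphere (cube _)).
  by move=> i; exact: segment_compact.
move=> u /=; rewrite form1E => u1 i.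
rewrite in_itv /= -ler_norml -(@ler_pXn2r _ 2) ?nnegrE // expr1n -u1.
rewrite real_normK ?num_real // (bigD1 i) //= expr2 lerDl sumr_ge0 //.
by move=> j _; rewrite -expr2 sqr_ge0.
Qed.

(** The form is nonnegative along the line [u + t z], where its value is
    [2 t form A u z + t ^+ 2 form A z z]; this is negative for a small [t] of
    suitable sign unless the linear coefficient vanishes. *)
Lemma psd_kernel A u z : A^T = A -> (forall v, 0 <= form A v v) ->
  form A u u = 0 -> form A u z = 0.
Proof.
move=> symA psd u0; set L := form A u z; set Q := form A z z.
have Q0 : 0 <= Q := psd z.
(* The constant 1 only keeps the denominator away from 0. *)
have := psd (u + (- L / (Q + 1)) *: z); rewrite form_expand // u0 -/L -/Q.
have Q1 : Q + 1 != 0 by rewrite gt_eqF //; lra.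
have -> : 0 + 2 * (- L / (Q + 1)) * L + (- L / (Q + 1)) ^+ 2 * Q
   = - (L ^+ 2 * (Q + 2) / (Q + 1) ^+ 2) by field.
rewrite oppr_ge0 pmulr_lle0 ?invr_gt0 ?exprn_gt0 //; last lra.
rewrite pmulr_lle0; last lra.
by move=> L2; apply/eqP; rewrite -sqrf_eq0 eq_le L2 sqr_ge0.
Qed.

(** At a maximizer [c] of the quadratic form on the unit sphere, with value [m],
    the matrix [m%:M - A] is positive semidefinite.  As [A] has nonnegative
    entries, replacing the entries of [c] by their absolute values does not
    decrease the form, so the resulting [u] is a maximizer too, and a zero of a
    positive semidefinite form lies in its kernel. *)
Lemma perron_symmetric A : (0 < n)%N -> A^T = A -> (forall i j, 0 <= A i j) ->
  exists m u, [/\ is_largest_eigenvalue A m, u *m A = m *: u,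
     forall i, 0 <= u 0 i & form 1%:M u u = 1].
Proof.
move=> n0 symA A0.
have [|c c1 cmax] := @EVT_max_rV R n (fun u => form A u u) _ _ compact_sphere
    (continuous_subspaceT (@continuous_form A)).
  exists (delta_mx 0 (Ordinal n0)); rewrite /= form1E (bigD1 (Ordinal n0)) //=.
  rewrite big1 ?mxE ?eqxx ?mulr1 ?addr0 // => i ne.
  by rewrite mxE (negbTE ne) andbF mul0r.
rewrite in_setE /= in c1.
pose m := form A c c.
pose u : 'rV[R]_n := map_mx Num.norm c.
have u1 : form 1%:M u u = 1.
  rewrite form1E -c1 form1E; apply: eq_bigr => i _.
  by rewrite mxE -normrM ger0_norm // -expr2 sqr_ge0.
pose B := m%:M - A.
have formB v w : form B v w = m * form 1%:M v w - form A v w.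
  rewrite !formE mulmxBr mulmxBl mul_mx_scalar mulmx1 -scalemxAl.
  by rewrite [LHS]mxE [X in X + _]mxE [X in _ + X]mxE.
have symB : B^T = B by rewrite /B linearB /= tr_scalar_mx symA.
(* By homogeneity it is enough to know the maximum on the unit sphere. *)
have psdB v : 0 <= form B v v.
  rewrite formB; have [->|v0] := eqVneq v 0.
    by rewrite !formE !mul0mx !mxE mulr0 subrr.
  set N := form 1%:M v v.
  have N0 : 0 < N.
    by rewrite lt_def form1_ge0 andbT; apply: contra v0 => /eqP/form1_eq0 ->.
  pose s := Num.sqrt N; have s2 : s ^+ 2 = N by rewrite sqr_sqrtr // ltW.
  have s0 : 0 < s by rewrite sqrtr_gt0.
  have := cmax (s^-1 *: v); rewrite in_setE /= !formZ -/N exprVn s2.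
  rewrite mulVf ?gt_eqF //.
  by move=> /(_ erefl); rewrite -/m ler_pdivrMl // mulrC subr_ge0.
have uker : form B u u = 0.
  apply/eqP; rewrite eq_le psdB andbT formB u1 mulr1 subr_le0 /m.
  apply: ler_sum => i _; apply: ler_sum => j _; rewrite !mxE.
  by rewrite (le_trans (ler_norm _)) // !normrM (ger0_norm (A0 i j)).
have eigu : u *m A = m *: u.
  have : u *m B = 0.
    apply: form1_eq0; rewrite {1}formE mulmx1 -formE.
    exact: psd_kernel.
  by rewrite mulmxBr mul_mx_scalar => /eqP; rewrite subr_eq0 => /eqP.
exists m, u; split => //; last by move=> i; rewrite mxE.
split.
  apply/eigenvalueP; exists u => //; apply: contra_eq_neq u1 => ->.
  by rewrite formE !mul0mx mxE eq_sym oner_eq0.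
move=> a /eigenvalueP [v va v0].
have vAv : form A v v = a * form 1%:M v v.
  by rewrite !formE va -scalemxAl mulmx1 mxE.
have := psdB v; rewrite formB vAv -mulrBl.
rewrite pmulr_lge0 ?subr_ge0 //.
by rewrite lt_def form1_ge0 andbT; apply: contra v0 => /eqP/form1_eq0 ->.
Qed.
End Rayleigh.

(** * Adjacency, distance and missing edges *)

Section Graphs.
Variable T : finType.
Implicit Types (G H : sgraph T) (x y : T).

Lemma adjacent_sym G : symmetric (adjacent G).
Proof. by move=> x y; rewrite /adjacent setUC. Qed.

Lemma adjacent_vertex G x y : adjacent G x y -> x \in vertices G.
Proof.
move=> xy; have /'forall_implyP /(_ _ xy) /andP[/subsetP sub _] := edgesP G.
by apply: sub; rewrite !inE eqxx.
Qed.

Lemma adjacent_neq G x y : adjacent G x y -> x != y.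
Proof.
move=> xy; have /'forall_implyP /(_ _ xy) /andP[_] := edgesP G.
by rewrite cards2 eqSS eqb1.
Qed.

Lemma subgraph_adjacent G H x y :
  subgraph H G -> adjacent H x y -> adjacent G x y.
Proof. by case=> _ /subsetP sub; exact: sub. Qed.

(** [distance] minimizes over a bounded range with a default that need not be
    the length of a path; a path has no repeated vertex, so its length lies in
    that range and a minimum is attained. *)
Lemma joined_by_distance G x y k :
  joined_by_path G x y k -> joined_by_path G x y (distance G x y).
Proof.
move=> jk; have ltk : (k < #|T|.+1)%N.
  case/existsP: (jk) => p /and3P[_ /card_uniqP cardp _].
  by have := max_card (mem (x :: p)); rewrite cardp /= size_tuple => /leqW.
rewrite /distance /arg_min /extremum; case: pickP => [i /andP[] //|none].
have := @arg_minnP _ (Ordinal ltk)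
  (fun i : 'I_#|T|.+1 => joined_by_path G x y i) (fun i => i : nat) jk.
case=> i Pi mini; have /negP[] := none i.
by rewrite /= Pi; apply/forall_inP.
Qed.

Lemma path_le_diameter G x y : connected_graph G ->
    x \in vertices G -> y \in vertices G ->
  exists p, [/\ path (adjacent G) x p, last x p = y & (size p <= diameter G)%N].
Proof.
move=> conn xG yG; have [k /joined_by_distance] := conn x y xG yG.
case/existsP=> p /and3P[xp _ /eqP <-].
exists p; split => //; rewrite size_tuple.
apply: leq_trans (leq_bigmax_cond _ xG); exact: leq_bigmax_cond.
Qed.

Definition missing G H x y := adjacent G x y && ~~ adjacent H x y.

Lemma missing_sym G H x y : missing G H x y = missing G H y x.
Proof. by rewrite /missing !(adjacent_sym _ x). Qed.

(** If no edge is missing then the two graphs have the same edges, hence some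
    vertex of [G] is not in [H]; the first edge of a path of [G] from there to
    [H] would be an edge of [H] at that vertex. *)
Lemma exists_missing G H : connected_graph G -> proper_subgraph H G ->
  exists x y, missing G H x y.
Proof.
move=> conn [[subV subE] neq].
have [/existsP[x /existsP[y xy]]|noneb] :=
  boolP [exists x, exists y, missing G H x y].
  by exists x, y.
have none x y : adjacent G x y -> adjacent H x y.
  move=> Gxy; apply: contraNT noneb => Hxy.
  by apply/existsP; exists x; apply/existsP; exists y; rewrite /missing Gxy.
case: neq; congr pair; last first.
  apply/eqP; rewrite eqEsubset subE; apply/subsetP => e eG.
  have /'forall_implyP /(_ _ eG) /andP[_ /cards2P[x [y [_ exy]]]] := edgesP G.
  by rewrite exy; apply: none; rewrite /adjacent -exy.
apply/eqP; rewrite eqEsubset subV; apply/subsetP => x xG.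
have /set0Pn[w wH] := vertices_neq0 H.
have [[|z p] [/= xp lastp _]] := path_le_diameter conn xG (subsetP subV _ wH).
  by rewrite lastp.
by case/andP: xp => /none /adjacent_vertex.
Qed.

End Graphs.

(** * Perron vectors of graphs *)

Section Perron.
Variables (R : realType) (T : finType).
Implicit Types (G H : sgraph T) (x y : T) (f g : T -> R).

(** Equality case of the Cauchy-Schwarz inequality for unit vectors, from
    [|f - g| ^ 2 = 2 (1 - <f, g>)]. *)
Lemma inner_unit_lt1 f g :
  \sum_x f x ^+ 2 = 1 -> \sum_x g x ^+ 2 = 1 ->
  \sum_x f x * g x < 1 \/ (forall x, f x = g x).
Proof.
move=> f1 g1; set S := \sum_x _.
have dist_fg : \sum_x (f x - g x) ^+ 2 = 2 * (1 - S).
  transitivity (\sum_x f x ^+ 2 - 2 * S + \sum_x g x ^+ 2).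
    rewrite /S big_distrr -sumrB -big_split.
    by apply: eq_bigr => x _ /=; ring.
  by rewrite f1 g1; ring.
have [S1|S1] := ltP S 1; [by left|right=> x].
apply/eqP; rewrite -subr_eq0 -sqrf_eq0; apply/eqP.
apply: (psumr_eq0P (P := xpredT) (F := fun x => (f x - g x) ^+ 2)) => //.
  by move=> y _; exact: sqr_ge0.
apply/eqP; rewrite eq_le sumr_ge0 ?andbT => [|y _]; last exact: sqr_ge0.
by rewrite dist_fg; lra.
Qed.

(** The vectors are extended by zero to all of [T], so that those of a graph
    and of its subgraph can be paired. *)
Definition perron G f : Prop :=
  [/\ forall x, 0 <= f x, forall x, x \notin vertices G -> f x = 0,
      \sum_x f x ^+ 2 = 1 &
      forall x, \sum_y (adjacent G x y)%:R * f y = mu R G * f x].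

Lemma mu_unique G m :
  is_largest_eigenvalue (adjacency_matrix R G) m -> mu R G = m.
Proof.
move=> largest; rewrite /mu.
have [eig_mu max_mu] := xgetPex 0 (ex_intro _ m largest).
have [eig_m max_m] := largest.
by apply/eqP; rewrite eq_le max_m // max_mu.
Qed.

Lemma perron_exists G : exists f, perron G f.
Proof.
have /set0Pn[x0 x0G] := vertices_neq0 G.
have [||i j|m [u [largest eigu u0 u1]]] :=
  @perron_symmetric R _ (adjacency_matrix R G).
- by rewrite card_gt0 vertices_neq0.
- by apply/matrixP => i j; rewrite !mxE adjacent_sym.
- by rewrite mxE ler0n.
pose f x := if x \in vertices G then u 0 (enum_rank_in x0G x) else 0.
have fE i : f (enum_val i) = u 0 i by rewrite /f enum_valP enum_valK_in.
have f_out x : x \notin vertices G -> f x = 0 by rewrite /f => /negbTE ->.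
have sum_f (F : T -> R) : (forall x, x \notin vertices G -> F x = 0) ->
    \sum_x F x = \sum_(i < #|vertices G|) F (enum_val i).
  move=> F_out; rewrite -big_enum_val [LHS](bigID (mem (vertices G))) /=.
  by rewrite [X in _ + X]big1 ?addr0.
exists f; split => // [x||x].
- by rewrite /f; case: ifP.
- rewrite sum_f => [|x xG]; last by rewrite f_out // expr0n.
  by rewrite -u1 form1E; apply: eq_bigr => i _; rewrite fE expr2.
rewrite (mu_unique largest) sum_f => [|y yG]; last by rewrite f_out // mulr0.
have [xG|xG] := boolP (x \in vertices G); last first.
  rewrite f_out // mulr0 big1 // => i _.
  by rewrite (contraNF (@adjacent_vertex _ G x _) xG) mul0r.
have /rowP /(_ (enum_rank_in x0G x)) := eigu.
rewrite !mxE -fE enum_rankK_in // => <-; apply: eq_bigr => i _.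
by rewrite !mxE enum_rankK_in // fE mulrC adjacent_sym.
Qed.

(** The second bound is the mean of the squared entries of a unit vector being
    at most the largest one. *)
Lemma perron_max G f : perron G f ->
  exists w, [/\ w \in vertices G, 0 < f w & 1 <= #|vertices G|%:R * f w ^+ 2].
Proof.
case=> f0 f_out f1 _; have /set0Pn[x0 x0G] := vertices_neq0 G.
case: (@real_arg_maxP R _ x0 (mem (vertices G)) f x0G) => [i _|w wG wmax].
  exact: num_real.
have f2 : 1 <= #|vertices G|%:R * f w ^+ 2.
  rewrite -[leLHS]f1 (bigID (mem (vertices G))) /=.
  rewrite [X in _ + X]big1 ?addr0 => [|x xG]; last first.
    by rewrite f_out // expr0n.
  rewrite mulr_natl -sumr_const; apply: ler_sum => x xG.
  by rewrite lerXn2r ?nnegrE //; exact: wmax.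
exists w; split => //; rewrite lt_def f0 andbT.
by apply: contraTneq f2 => ->; rewrite expr0n mulr0 ler10.
Qed.

Lemma perron_step G f x y : perron G f -> adjacent G x y ->
  f y <= mu R G * f x.
Proof.
case=> f0 _ _ eigf xy; rewrite -eigf (bigD1 y) //= xy mul1r lerDl.
by rewrite sumr_ge0 // => z _; rewrite mulr_ge0.
Qed.

Lemma mu_ge0 G : 0 <= mu R G.
Proof.
have [f pf] := perron_exists G; have [w [_ w0 _]] := perron_max pf.
case: pf => f0 _ _ eigf; rewrite -(pmulr_lge0 _ w0) -eigf.
by rewrite sumr_ge0 // => z _; rewrite mulr_ge0.
Qed.

Lemma perron_path G f x p : perron G f -> path (adjacent G) x p ->
  f (last x p) <= mu R G ^+ size p * f x.
Proof.
move=> pf; elim: p x => [|y p IHp] x /=; first by rewrite mul1r.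
case/andP => xy /IHp /le_trans; apply.
by rewrite exprSr -mulrA ler_wpM2l ?exprn_ge0 ?mu_ge0 // perron_step.
Qed.

Lemma perron_gt0 G f x : connected_graph G -> perron G f ->
  x \in vertices G -> 0 < f x.
Proof.
move=> conn pf xG; have [w [wG w0 _]] := perron_max pf.
have [p [xp lastp _]] := path_le_diameter conn xG wG.
have := perron_path pf xp; rewrite lastp => /(lt_le_trans w0).
by apply: contraTT; rewrite -!leNgt => fx;
  rewrite mulr_ge0_le0 ?exprn_ge0 ?mu_ge0.
Qed.

(** The two ends of an edge have positive entries, each at most [mu R G] times
    the other, so that [1 <= mu R G ^+ 2]. *)
Lemma mu_ge1 G x y : connected_graph G -> adjacent G x y -> 1 <= mu R G.
Proof.
move=> conn xy; have [f pf] := perron_exists G.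
have fy : 0 < f y.
  rewrite adjacent_sym in xy.
  exact: perron_gt0 conn pf (adjacent_vertex xy).
rewrite -(@ler_pXn2r _ 2) ?nnegrE ?mu_ge0 // expr1n.
rewrite -(ler_pM2r fy) mul1r expr2 -mulrA.
apply: le_trans (perron_step pf xy) _.
rewrite ler_wpM2l ?mu_ge0 // perron_step //.
by rewrite adjacent_sym.
Qed.

Lemma perron_lower_bound G f x :
  connected_graph G -> 1 <= mu R G -> perron G f -> x \in vertices G ->
  1 <= #|vertices G|%:R * (mu R G ^+ diameter G * f x) ^+ 2.
Proof.
move=> conn mu1 pf xG; have [w [wG w0 /le_trans]] := perron_max pf; apply.
have [p [xp lastp sizep]] := path_le_diameter conn xG wG.
have f0 : 0 <= f x by case: pf.
have le_w : f w <= mu R G ^+ diameter G * f x.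
  rewrite -lastp; apply: le_trans (perron_path pf xp) _.
  by rewrite ler_wpM2r // ler_weXn2l.
rewrite ler_wpM2l // lerXn2r ?nnegrE // ?(ltW w0) //.
by rewrite mulr_ge0 // exprn_ge0 // mu_ge0.
Qed.

(** As long as the walk meets no end of a missing edge, its edges lie in [H],
    and each of them costs a factor of at most [mu R H <= m]; the walk is cut at
    the first such end, and [1 <= m] absorbs the part that is dropped. *)
Lemma perron_escape G H g m w p u : perron H g -> 1 <= m -> mu R H <= m ->
  path (adjacent G) w p -> last w p = u -> (exists v, missing G H u v) ->
  exists u' v', missing G H u' v' /\ g w <= m ^+ size p * g u'.
Proof.
move=> pg m1 muH; have g0 : forall x, 0 <= g x by case: pg.
elim: p w => [|z p IHp] w /=.
  by move=> _ -> [v uv]; exists u, v; rewrite mul1r.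
case/andP => wz zp lastp bad_u.
have [/existsP[v wv]|/existsPn good] := boolP [exists v, missing G H w v].
  by exists w, v; split => //; rewrite ler_peMl // exprn_ege1.
have Hzw : adjacent H z w.
  by have := good z; rewrite /missing wz /= negbK adjacent_sym.
have [u' [v' [uv' le_z]]] := IHp _ zp lastp bad_u.
exists u', v'; split => //; apply: le_trans (perron_step pg Hzw) _.
apply: (@le_trans _ _ (m * g z)); first by rewrite ler_wpM2r.
by rewrite exprS -mulrA ler_wpM2l // (le_trans ler01).
Qed.

(** * The spectral gap in terms of missing edges *)

(** Both adjacency matrices are symmetric: the one of [G] acts on [f], the one
    of [H] on [g]. *)
Lemma mu_diff_inner G H f g : perron G f -> perron H g ->
  (mu R G - mu R H) * \sum_x f x * g x
  = \sum_x \sum_y ((adjacent G x y)%:R - (adjacent H x y)%:R) * (f x * g y).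
Proof.
move=> [_ _ _ eigf] [_ _ _ eigg].
have -> : (mu R G - mu R H) * \sum_x f x * g x =
    \sum_y mu R G * f y * g y - \sum_x f x * (mu R H * g x).
  by rewrite mulrBl !big_distrr /=; congr (_ - _); apply: eq_bigr => x _; ring.
have -> : \sum_y mu R G * f y * g y =
    \sum_x \sum_y (adjacent G x y)%:R * (f x * g y).
  rewrite exchange_big; apply: eq_bigr => y _; rewrite -eigf big_distrl.
  by apply: eq_bigr => x _; rewrite adjacent_sym mulrA.
rewrite -sumrB; apply: eq_bigr => x _; rewrite -eigg big_distrr -sumrB.
by apply: eq_bigr => y _ /=; ring.
Qed.

Lemma mu_diff_lower_bound G H f g u v : subgraph H G ->
  perron G f -> perron H g -> missing G H u v ->
  f v * g u + f u * g v <= (mu R G - mu R H) * \sum_x f x * g x.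
Proof.
move=> sub pf pg uv; rewrite (mu_diff_inner pf pg).
have f0 : forall x, 0 <= f x by case: pf.
have g0 : forall x, 0 <= g x by case: pg.
have term0 x y : 0 <= ((adjacent G x y)%:R - (adjacent H x y)%:R) * (f x * g y).
  rewrite mulr_ge0 ?mulr_ge0 // subr_ge0 ler_nat.
  by have := @subgraph_adjacent _ G H x y sub; case: adjacent => // ->.
have row x y : missing G H x y -> f x * g y <=
    \sum_z ((adjacent G x z)%:R - (adjacent H x z)%:R) * (f x * g z).
  case/andP => Gxy /negbTE Hxy; rewrite (bigD1 y) //= Gxy Hxy subr0 mul1r lerDl.
  by rewrite sumr_ge0.
have uNv : u != v by case/andP: uv => /adjacent_neq.
rewrite (bigD1 v) //= [X in _ <= _ + X](bigD1 u) //= addrA.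
apply: ler_wpDr; first by rewrite sumr_ge0 // => x _; rewrite sumr_ge0.
by rewrite lerD // row // missing_sym.
Qed.

End Perron.

Theorem theorem1 (R : realType) (T : finType) (G H : sgraph T) (n D : nat)
    (hconn : connected_graph G) (hn : #|vertices G| = n)
    (hD : diameter G = D) (hH : proper_subgraph H G) :
  mu R G - mu R H > 1 / (mu R G ^+ (2 * D)%N * n%:R).
Proof.
have [sub _] := hH.
have [u0 [v0 uv0]] := exists_missing hconn hH.
have mu1 : 1 <= mu R G by case/andP: uv0 => /(mu_ge1 R hconn).
have [f pf] := perron_exists R G; have [g pg] := perron_exists R H.
have f0 x : 0 <= f x by case: pf => f0 _ _ _; exact: f0.
have g0 x : 0 <= g x by case: pg => g0 _ _ _; exact: g0.
have [w [wH gw0 gw]] := perron_max pg.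
have wG : w \in vertices G by case: sub => /subsetP subV _; exact: subV.
set S := \sum_x f x * g x.
have S0 : 0 < S.
  rewrite /S (bigD1 w) //= ltr_pwDl ?mulr_gt0 ?(perron_gt0 hconn pf) //.
  by rewrite sumr_ge0 // => x _; rewrite mulr_ge0.
(* The same identity, for any missing edge, already gives monotonicity. *)
have muH : mu R H <= mu R G.
  have := mu_diff_lower_bound sub pf pg uv0; rewrite -/S => le_d.
  rewrite -subr_ge0 -(pmulr_lge0 _ S0); apply: le_trans le_d.
  by rewrite addr_ge0 // mulr_ge0.
have u0G : u0 \in vertices G by case/andP: uv0 => /adjacent_vertex.
have [p [wp lastp sizep]] := path_le_diameter hconn wG u0G.
have [u [v [uv gwu]]] := perron_escape pg mu1 muH wp lastp (ex_intro _ v0 uv0).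
have uG : u \in vertices G by case/andP: uv => /adjacent_vertex.
have vG : v \in vertices G.
  by move: uv; rewrite missing_sym; case/andP => /adjacent_vertex.
have fu := perron_gt0 hconn pf uG; have fv := perron_gt0 hconn pf vG.
set c := 1 / _.
have K0 : 0 < mu R G ^+ D by rewrite exprn_gt0 // (lt_le_trans ltr01).
have n0 : 0 < n%:R :> R by rewrite -hn ltr0n card_gt0 vertices_neq0.
(* Maximality of [g w] is used with the order of [H], which is at most [n]. *)
have gu : 1 <= n%:R * (mu R G ^+ D * g u) ^+ 2.
  apply: le_trans gw _; apply: ler_pM => //; first by rewrite sqr_ge0.
    by rewrite -hn ler_nat subset_leq_card //; case: sub.
  rewrite lerXn2r ?nnegrE ?(ltW gw0) ?mulr_ge0 ?(ltW K0) //.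
  by apply: le_trans gwu _; rewrite ler_wpM2r // ler_weXn2l // -hD.
(* Squaring avoids the square roots of the two bounds by [1 / n]. *)
have c_le : c <= f v * g u.
  rewrite /c ler_pdivrMr ?mulr_gt0 ?exprn_gt0 ?(lt_le_trans ltr01 mu1) //.
  rewrite -(@ler_pXn2r _ 2) ?nnegrE ?mulr_ge0 ?exprn_ge0 ?mu_ge0 // expr1n.
  have := perron_lower_bound hconn mu1 pf vG; rewrite hn hD => fv1.
  apply: le_trans (mulr_ege1 fv1 gu) _.
  by rewrite mul2n -addnn exprD le_eqVlt; apply/orP; left; apply/eqP; ring.
have c0 : 0 < c.
  by rewrite /c divr_gt0 ?mulr_gt0 ?exprn_gt0 ?(lt_le_trans ltr01 mu1).
have le_dS := mu_diff_lower_bound sub pf pg uv; rewrite -/S in le_dS.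
have d0 : 0 <= mu R G - mu R H by rewrite subr_ge0.
have [_ _ f1 _] := pf; have [_ _ g1 _] := pg.
have [S1|fg] := inner_unit_lt1 f1 g1.
  have fugv : 0 <= f u * g v by rewrite mulr_ge0.
  by rewrite -/S in S1; nra.
have S_eq1 : S = 1 by rewrite -f1; apply: eq_bigr => x _; rewrite -fg expr2.
have fugv : 0 < f u * g v by rewrite -fg mulr_gt0.
by move: le_dS; rewrite S_eq1; lra.
Qed.
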